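(* Let $G=G_1\times G_2$ be an infinite group. Then $G$ is $\mathfrak{Z}_{mon}$-cofinite if and only if either both groups $G_1,G_2$ satisfy the Weak Cancellation Law (WCL), or there exists a prime $p$ such that both groups $G_1,G_2$ have exponent $p$.
   Context: For a group $G$ with neutral element $e$, the monomial topology $\mathfrak{Z}_{mon,G}$ is the topology on $G$ having as a subbase of its closed sets the family of all sets $\{x\in G : g x^n = e\}$ with $g\in G$, $n\in\mathbb{N}$. The group $G$ is called $\mathfrak{Z}_{mon}$-cofinite if $\mathfrak{Z}_{mon,G}$ is the cofinite topology on $G$ (closed sets: $G$ and the finite subsets of $G$). A group $G$ satisfies WCL if for every integer $n>0$ the map $x\mapsto x^n$, $G\to G$, is finitely-many-to-one, i.e. every fiber is finite. For a positive integer $m$ put $G[m]=\{g\in G : g^m=e\}$; a group $G$ is of finite exponent if $G=G[m]$ for some positive integer $m$, and the smallest such $m$ is called the exponent of $G$.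
   Formalization: Both groups G_1 and G_2 are assumed nontrivial; otherwise the claim fails, e.g. for G_1 trivial and G_2 an infinite elementary abelian p-group, where G is cofinite but G_2 is not WCL and G_1 has exponent 1. *)

(* Defs.v *)
From HB Require Import structures.
From mathcomp Require Import all_boot.
From mathcomp Require Import all_classical.
From mathcomp Require Import topology_structure.

Set Implicit Arguments.
Unset Strict Implicit.
Unset Printing Implicit Defensive.

Local Open Scope classical_set_scope.
Local Open Scope group_scope.

Definition monomial_set (G : groupType) (g : G) (n : nat) : set G :=
  [set x | g * x ^+ n = 1].

Definition monomial_family (G : groupType) : set (set G) :=
  [set B | exists (g : G) (n : nat), B = monomial_set g n].
Arguments monomial_family : clear implicits.

(* A copy of [G] carrying the monomial topology. The library generates a
   topology from a subbase of open sets, hence the complements. *)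
Definition Zmon (G : groupType) : Type := G.

HB.instance Definition _ (G : groupType) := Choice.on (Zmon G).

HB.instance Definition _ (G : groupType) :=
  @isSubBaseTopological.Build (Zmon G) (set G)
    [set ~` B | B in monomial_family G] id.

Definition Zmon_cofinite (G : groupType) : Prop :=
  forall A : set (Zmon G), closed A <-> A = setT \/ finite_set A.

Definition WCL (G : groupType) : Prop :=
  forall n : nat, (0 < n)%N ->
  forall y : G, finite_set [set x : G | x ^+ n = y].

Definition group_torsion (G : groupType) (m : nat) : set G :=
  [set g | g ^+ m = 1].
Arguments group_torsion : clear implicits.

Definition has_exponent (G : groupType) (m : nat) : Prop :=
  [/\ (0 < m)%N,
      group_torsion G m = setT
    & forall k : nat, (0 < k)%N -> group_torsion G k = setT -> (m <= k)%N].

(* Nontriviality of both factors cannot be dropped: if [G1] is trivial and [G2]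
   is infinite of prime exponent p, then [G1 * G2] is Zmon-cofinite, but [G2] is
   not WCL and [G1] has exponent 1. *)
Definition nontrivial_group (G : groupType) : Prop := exists x : G, x <> 1.

(* Main.v *)
Require Import Defs.
From mathcomp Require Import all_boot finmap.
From mathcomp Require Import all_classical.
From mathcomp Require Import topology_structure.

(** The closed sets of the monomial topology are built from the fibers of the
    power maps x |-> x ^+ n, so the topology is cofinite exactly when every such
    fiber is finite or the whole group (Zmon_cofiniteP).  Since n = 1 gives the
    singletons, the topology always contains the cofinite one.

    For a nontrivial group G, this dichotomy is decided by a counting argument
    (fibers_finite_or_fullP).  If some power map with n > 0 has an infinite
    fiber, that fiber is all of G, so it is the fiber of 1 and G has finite
    exponent; let n be the least one.  Were n = a * b with 1 < a, b < n, then
    G[b] would not be all of G, hence would be finite; but x |-> x ^+ a maps G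
    into G[b], with fibers that are not all of G either, hence finite.  So G
    would be finite, which is absurd: n is prime.  Conversely, in exponent p, the
    power maps are constant when p divides n and injective otherwise.

    Both alternatives pass to the factors of a direct product, because powers
    and fibers are computed componentwise, and nontriviality turns
    G_i = G_i[p] into G_i having exponent exactly p. *)

Local Open Scope classical_set_scope.
Local Open Scope group_scope.

Lemma monomial_set_fiber (G : groupType) (g : G) (n : nat) :
  monomial_set g n = [set x | x ^+ n = g^-1].
Proof.
apply/seteqP; split=> x /=; rewrite /monomial_set /=.
  by move=> /(canRL (mulKg g)); rewrite mulg1.
by move=> ->; rewrite mulgV.
Qed.

Lemma closed_power_fiber (G : groupType) (n : nat) (y : G) :
  closed ([set x | x ^+ n = y] : set (Zmon G)).
Proof.
rewrite -openC.
have -> : [set x | x ^+ n = y] = monomial_set y^-1 n.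
  by rewrite monomial_set_fiber invgK.
set B := monomial_set _ _.
exists [set ~` B]; last by rewrite bigcup_set1.
move=> _ ->; apply: finI_from1.
by exists B => //; exists y^-1, n.
Qed.

Lemma finite_closed_Zmon (G : groupType) (A : set (Zmon G)) :
  finite_set A -> closed A.
Proof.
move=> finA; have -> : A = \bigcup_(y in A) [set x : G | x ^+ 1 = y].
  apply/seteqP; split=> x; first by move=> Ax; exists x.
  by move=> [y Ay /= xy]; move: Ay; rewrite -xy.
by apply: closed_bigcup => // y _; exact: closed_power_fiber.
Qed.

(** Unfolds the generated topology, so that its index types are plain sets. *)
Lemma open_ZmonP (G : groupType) (U : set (Zmon G)) :
  open U <->
  exists2 D : set (set G),
    D `<=` finI_from [set ~` B | B in monomial_family G] id
    & \bigcup_(V in D) V = U.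
Proof. by []. Qed.

(** A point outside a closed set lies in a basic open set disjoint from it, so
    the closed set is covered by finitely many subbasic closed sets, all
    missing that point. *)
Lemma closed_sub_monomials {G : groupType} {A : set (Zmon G)} {x : G} :
  closed A -> ~ A x ->
  exists F : set (set G),
    [/\ finite_set F,
        F `<=` [set B | exists g n, B = monomial_set g n /\ ~ B x]
      & A `<=` \bigcup_(B in F) B].
Proof.
rewrite -openC => /open_ZmonP[D' D'sub D'A] nAx.
have [U D'U Ux] : (\bigcup_(U in D') U) x by rewrite D'A.
have [F Fsub FU] := D'sub _ D'U.
exists [set ~` V | V in [set` F]]; split.
- by apply: finite_image; exact: finite_fset.
- move=> _ [V FV <-] /=.
  have := Fsub _ FV; rewrite inE => -[B [g [n ->]] BV].
  exists g, n; rewrite -BV setCK; split=> // nVx.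
  move: Ux; rewrite -FU => /(_ V FV); rewrite -BV => Vx.
  exact: nVx Vx.
- move=> z Az; apply: contrapT => nz.
  have : (\bigcup_(U in D') U) z.
    exists U => //; rewrite -FU => V FV /=.
    apply: contrapT => nVz; apply: nz.
    by exists (~` V) => //; exists V.
  by rewrite D'A; apply.
Qed.

Lemma Zmon_cofiniteP (G : groupType) :
  Zmon_cofinite G <->
  forall (n : nat) (y : G),
    [set x | x ^+ n = y] = setT \/ finite_set [set x | x ^+ n = y].
Proof.
split=> [cofG n y | fib A]; first exact/cofG/closed_power_fiber.
split=> [clA | [-> | finA]]; last 2 first.
- exact: closedT.
- exact: finite_closed_Zmon.
have [AT | /existsNP[x nAx]] := pselect (forall x, A x).
  by left; apply/seteqP; split.
right; have [F [finF Fsub AF]] := closed_sub_monomials clA nAx.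
apply: (sub_finite_set AF); apply: bigcup_finite => // B /Fsub[g [n [-> nBx]]].
rewrite monomial_set_fiber in nBx *.
by have [fT | //] := fib n g^-1; case: nBx; rewrite fT.
Qed.

Lemma power_fiber_full {G : groupType} {n : nat} {y : G} :
  [set x | x ^+ n = y] = setT -> y = 1.
Proof.
move=> fT; have : [set x | x ^+ n = y] 1 by rewrite fT.
by rewrite /= expg1n.
Qed.

Lemma group_torsionT (G : groupType) (m : nat) :
  group_torsion G m = setT <-> forall x : G, x ^+ m = 1.
Proof.
split=> [GT x | Gm]; last by apply/seteqP; split=> // x _; exact: Gm.
by have : group_torsion G m x by rewrite GT.
Qed.

(** In exponent p, Bezout inverts the n-th power map by a k-th power, with
    n * k congruent to 1 modulo p. *)
Lemma expg_prime_coprime {G : groupType} {p n : nat} :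
  prime p -> ~~ (p %| n)%N -> (forall x : G, x ^+ p = 1) ->
  exists k : nat, forall x : G, x ^+ n ^+ k = x.
Proof.
move=> p_pr pNn Gp.
have n0 : (0 < n)%N by case: n pNn => //; rewrite dvdn0.
have co : coprime n p by rewrite coprime_sym prime_coprime.
have [k l kl _] := egcdnP p n0; exists k => x.
rewrite -expgnA mulnC kl (eqP co) expgnDr mulnC expgnA Gp.
by rewrite expg1n mul1g expg1.
Qed.

Lemma has_prime_exponentP (G : groupType) (p : nat) :
  nontrivial_group G -> prime p ->
  has_exponent G p <-> forall x : G, x ^+ p = 1.
Proof.
move=> [z z1] p_pr; split=> [[_ /group_torsionT //] | Gp].
split; [exact: prime_gt0 | exact/group_torsionT |].
move=> m m0 /group_torsionT Gm; apply: dvdn_leq => //.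
apply/negPn/negP => pNm; have [k Gk] := expg_prime_coprime p_pr pNm Gp.
by apply: z1; rewrite -(Gk z) Gm expg1n.
Qed.

Lemma prime_exponent_fibers {G : groupType} {p : nat} (n : nat) (y : G) :
  prime p -> (forall x : G, x ^+ p = 1) ->
  [set x | x ^+ n = y] = setT \/ finite_set [set x | x ^+ n = y].
Proof.
move=> p_pr Gp; have [/dvdnP[q ->] | pNn] := boolP (p %| n)%N.
  have Gn (x : G) : x ^+ (q * p) = 1 by rewrite mulnC expgnA Gp expg1n.
  have [-> | y1] := pselect (y = 1); [left | right].
    by apply/seteqP; split=> // x _; exact: Gn.
  apply: (@sub_finite_set _ _ set0) => // x /=.
  by rewrite Gn => /esym.
right; have [k Gk] := expg_prime_coprime p_pr pNn Gp.
by apply: (@sub_finite_set _ _ [set y ^+ k]) => // x /= <-.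
Qed.

Lemma WCL_fibers {G : groupType} (n : nat) (y : G) :
  WCL G -> [set x | x ^+ n = y] = setT \/ finite_set [set x | x ^+ n = y].
Proof.
move=> wG; case: n => [|n]; last by right; exact: wG.
have [-> | y1] := pselect (y = 1); [left | right].
  by apply/seteqP; split.
by apply: (@sub_finite_set _ _ set0) => // x /= /esym.
Qed.

(** The map x |-> x ^+ a sends G = G[a * b] into the finite set G[b]. *)
Lemma composite_exponent_finite {G : groupType} {a b : nat} :
  (forall x : G, x ^+ (a * b) = 1) -> finite_set (group_torsion G b) ->
  (forall y : G, finite_set [set x : G | x ^+ a = y]) ->
  finite_set [set: G].
Proof.
move=> Gab finb fina.
have -> : [set: G] = \bigcup_(y in group_torsion G b) [set x : G | x ^+ a = y].
  apply/seteqP; split=> // x _; exists (x ^+ a) => //.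
  by rewrite /group_torsion /= -expgnA.
by apply: bigcup_finite => // y _; exact: fina.
Qed.

(** The exponent argument needs an infinite fiber to start from: it makes G
    infinite, which rules out a composite exponent.  Nontriviality rules out
    exponent 1. *)
Lemma fibers_finite_or_fullP (G : groupType) :
  nontrivial_group G ->
  (forall (n : nat) (y : G),
     [set x | x ^+ n = y] = setT \/ finite_set [set x | x ^+ n = y]) <->
  WCL G \/ exists2 p : nat, prime p & forall x : G, x ^+ p = 1.
Proof.
move=> [z z1]; split=> [fib | [wG | [p p_pr Gp]] n y]; last 2 first.
- exact: WCL_fibers.
- exact: prime_exponent_fibers p_pr Gp.
have [wG | nwG] := pselect (WCL G); [by left | right].
have [n [n0 [y infy]]] : exists n, (0 < n)%N /\
    exists y : G, ~ finite_set [set x : G | x ^+ n = y].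
  apply: contrapT => nex; apply: nwG => n n0 y; apply: contrapT => infy.
  by apply: nex; exists n; split=> //; exists y.
have [fT | //] := fib n y.
(* The infinite fiber is full, so it is the fiber of 1 and G = G[n]. *)
have infG : ~ finite_set [set: G] by rewrite -fT.
have exG : exists n, `[< (0 < n)%N /\ forall x : G, x ^+ n = 1 >].
  exists n; apply/asboolP; split=> //; apply/group_torsionT.
  by rewrite -fT /group_torsion (power_fiber_full fT).
case: (ex_minnP exG) => m /asboolP[m0 Gm] m_min.
(* A full fiber of x |-> x ^+ d with 0 < d < m would contradict the minimality
   of the exponent m. *)
have proper_fiber d (y' : G) : (0 < d < m)%N ->
    finite_set [set x : G | x ^+ d = y'].
  move=> /andP[d0 dm]; have [dT | //] := fib d y'.
  have : (m <= d)%N; last by rewrite leqNgt dm.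
  apply/m_min/asboolP; split=> //; apply/group_torsionT.
  by rewrite -dT /group_torsion (power_fiber_full dT).
exists m => //; apply/negPn/negP => /primePn[m2 | [d /andP[d1 dm] dvd_dm]].
  by apply: z1; move: m0 m2 (Gm z); case: m {Gm m_min proper_fiber} => [|[]].
have {dvd_dm} [c mE] := dvdnP dvd_dm.
have d0 : (0 < d)%N := ltnW d1.
have c0 : (0 < c)%N by move: m0; rewrite mE muln_gt0 => /andP[].
have cm : (c < m)%N by rewrite mE ltn_Pmulr.
apply: infG; apply: (@composite_exponent_finite G c d).
- by rewrite -mE.
- by apply: proper_fiber; rewrite d0.
- by move=> y'; apply: proper_fiber; rewrite c0.
Qed.

Lemma expg_pair (G1 G2 : groupType) (x : (G1 * G2)%type) (n : nat) :
  x ^+ n = (x.1 ^+ n, x.2 ^+ n).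
Proof. by elim: n => [|n IHn]; rewrite ?expgS ?IHn. Qed.

Lemma power_fiber_pair (G1 G2 : groupType) (n : nat) (y : (G1 * G2)%type) :
  [set x | x ^+ n = y] =
  [set x1 | x1 ^+ n = y.1] `*` [set x2 | x2 ^+ n = y.2].
Proof.
case: y => y1 y2; apply/seteqP; split=> x /=; rewrite expg_pair.
  by case.
by case=> /= -> ->.
Qed.

Lemma WCL_pair (G1 G2 : groupType) :
  WCL (G1 * G2)%type <-> WCL G1 /\ WCL G2.
Proof.
split=> [wG | [w1 w2] n n0 y]; last first.
  by rewrite power_fiber_pair; apply: finite_setX; [exact: w1 | exact: w2].
split=> n n0 y.
  have /(finite_image fst) := wG n n0 (y, 1); apply: sub_finite_set => x xy.
  by exists (x, 1) => //=; rewrite expg_pair /= xy expg1n.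
have /(finite_image snd) := wG n n0 (1, y); apply: sub_finite_set => x xy.
by exists (1, x) => //=; rewrite expg_pair /= xy expg1n.
Qed.

Lemma expg_pair_eq1 (G1 G2 : groupType) (n : nat) :
  (forall x : (G1 * G2)%type, x ^+ n = 1) <->
  (forall x1 : G1, x1 ^+ n = 1) /\ (forall x2 : G2, x2 ^+ n = 1).
Proof.
split=> [Gn | [Gn1 Gn2] x]; last by rewrite expg_pair Gn1 Gn2.
split=> x.
  by have := Gn (x, 1); rewrite expg_pair => -[].
by have := Gn (1, x); rewrite expg_pair => -[].
Qed.

Theorem theorem5p16 (G1 G2 : groupType)
    (nontriv1 : nontrivial_group G1) (nontriv2 : nontrivial_group G2)
    (infG : infinite_set [set: (G1 * G2)%type]) :
  Zmon_cofinite (G1 * G2)%type <->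
  (WCL G1 /\ WCL G2) \/
  (exists p : nat, [/\ prime p, has_exponent G1 p & has_exponent G2 p]).
Proof.
have nontriv : nontrivial_group (G1 * G2)%type.
  by have [z z1] := nontriv1; exists (z, 1) => -[].
rewrite Zmon_cofiniteP fibers_finite_or_fullP // WCL_pair.
split=> -[wG | ]; [by left | move=> [p p_pr] | by left | move=> [p [p_pr]]].
  by move=> /expg_pair_eq1[Gp1 Gp2]; right; exists p; split=> //;
    apply/has_prime_exponentP.
move=> /has_prime_exponentP-/(_ nontriv1 p_pr) Gp1.
move=> /has_prime_exponentP-/(_ nontriv2 p_pr) Gp2.
by right; exists p => //; apply/expg_pair_eq1.
Qed.
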